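(* Let $RR$ be a $Jf$-relative monad and $C(RR)$ the associated C-system. The function $$mb_{RR}:\widetilde{Ob}(C(RR))\to\coprod_{n\in\mathbb N}RR(n),\qquad (s:\widehat n\to\widehat{n+1})\mapsto(n,s(n)),$$ is a bijection, with inverse $mb^!_{RR}$ sending $(n,o)$, $o\in RR(n)$, to the morphism $(x_0^n,\dots,x_{n-1}^n,o):\widehat n\to\widehat{n+1}$.
   Context: Composition is in diagrammatic order: $f\circ g$ means first $f$, then $g$. $stn(n)=\{0,\dots,n-1\}$, $Fun(X,Y)$ is the set of functions $X\to Y$, $F(m,n)=Fun(stn(m),stn(n))$. A $Jf$-relative monad $RR$ consists of sets $RR(n)$ ($n\in\mathbb N$), functions $\eta(n):stn(n)\to RR(n)$, and for each $f\in RR(m,n):=Fun(stn(m),RR(n))$ a function $\rho(f):RR(m)\to RR(n)$, such that $\rho(\eta(n))=Id_{RR(n)}$, $\eta(m)\circ\rho(f)=f$ and $\rho(f)\circ\rho(g)=\rho(f\circ\rho(g))$ for $f\in RR(l,m)$, $g\in RR(m,n)$. Elements $f\in RR(m,n)$ are written as sequences $(f(0),\dots,f(m-1))$. The Kleisli category has objects $\mathbb N$, morphisms $m\to n$ the elements of $RR(m,n)$ (tagged by $m,n$), composition $f\circ_T g=f\circ\rho(g)$ and identities $\eta(m)$. For $f\in F(m,n)$ put $L(f)=f\circ\eta(n)\in RR(m,n)$. Put $x_i^n=\eta(n)(i)\in RR(n)$; $\iota_n^1:stn(n)\to stn(n+1)$ is $j\mapsto j$. The category underlying $C(RR)$ is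 the opposite of the Kleisli category; the object $n$ is written $\widehat n$, so morphisms $\widehat m\to\widehat n$ are elements of $RR(n,m)$ and the composite of $f:\widehat l\to\widehat m$ and $g:\widehat m\to\widehat n$ is $g\circ_T f$. In $C(RR)$: $l(\widehat n)=n$, $ft(\widehat{n+1})=\widehat n$, $ft(\widehat 0)=\widehat 0$, $p_{\widehat 0}=Id$, $p_{\widehat{n+1}}=L(\iota_n^1)=(x_0^{n+1},\dots,x_{n-1}^{n+1}):\widehat{n+1}\to\widehat n$. $\widetilde{Ob}(C(RR))$ is the set of morphisms $s:ft(X)\to X$ with $l(X)>0$ and $s\circ p_X=Id_{ft(X)}$. *)

(* Defs.v *)
From mathcomp Require Import all_boot.
From Stdlib Require Import FunctionalExtensionality.

Set Implicit Arguments.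
Unset Strict Implicit.
Unset Printing Implicit Defensive.

(* Composition is written in diagrammatic order everywhere: [comp f g], like
   MathComp's [f \; g], is first [f], then [g]. *)

Record category := Category {
  obj :> Type;
  hom : obj -> obj -> Type;
  idm : forall X, hom X X;
  comp : forall X Y Z, hom X Y -> hom Y Z -> hom X Z;
  comp_idl : forall X Y (f : hom X Y), comp (idm X) f = f;
  comp_idr : forall X Y (f : hom X Y), comp f (idm Y) = f;
  comp_assoc : forall W X Y Z (f : hom W X) (g : hom X Y) (h : hom Y Z),
    comp (comp f g) h = comp f (comp g h)
}.
Arguments hom {c} X Y.
Arguments idm {c} X.
Arguments comp {c X Y Z} f g.

Definition opposite (C : category) : category :=
  @Category C (fun X Y => @hom C Y X) (@idm C)
    (fun X Y Z f g => @comp C Z Y X g f)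
    (fun X Y f => comp_idr f) (fun X Y f => comp_idl f)
    (fun W X Y Z f g h => esym (comp_assoc h g f)).

Definition cast_cod (C : category) (X Y Z : C) (e : Y = Z) (f : hom X Y) :
  hom X Z := eq_rect Y (fun T => hom X T) f Z e.

(* [pull hX f] is the object f^*X and [q hX f] the morphism q(f,X) of a
   C-system.  Equalities between morphisms whose domains are only
   propositionally equal are stated between dependent pairs (domain, morphism). *)
Record Csystem := {
  ccat :> category;
  len : ccat -> nat;
  pt : ccat;
  ft : ccat -> ccat;
  pr : forall X : ccat, hom X (ft X);
  pull : forall X Y : ccat, 0 < len X -> hom Y (ft X) -> ccat;
  q : forall (X Y : ccat) (hX : 0 < len X) (f : hom Y (ft X)),
    hom (pull hX f) X;
  len_eq0 : forall X, len X = 0 <-> X = pt;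
  len_ft : forall X, 0 < len X -> len (ft X) = (len X).-1;
  ft_pt : ft pt = pt;
  pt_final : forall X : ccat, exists f : hom X pt, forall g : hom X pt, g = f;
  len_pull : forall (X Y : ccat) (hX : 0 < len X) (f : hom Y (ft X)),
    0 < len (pull hX f);
  ft_pull : forall (X Y : ccat) (hX : 0 < len X) (f : hom Y (ft X)),
    ft (pull hX f) = Y;
  pull_square : forall (X Y : ccat) (hX : 0 < len X) (f : hom Y (ft X)),
    comp (cast_cod (ft_pull hX f) (pr (pull hX f))) f = comp (q hX f) (pr X);
  pull_id : forall (X : ccat) (hX : 0 < len X),
    existT (fun T => hom T X) (pull hX (idm (ft X))) (q hX (idm (ft X)))
    = existT (fun T => hom T X) X (idm X);
  pull_comp : forall (X Y Z : ccat) (hX : 0 < len X)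
      (f : hom Y (ft X)) (g : hom Z Y),
    let g' := cast_cod (esym (ft_pull hX f)) g in
    existT (fun T => hom T X) (pull hX (comp g f)) (q hX (comp g f))
    = existT (fun T => hom T X) (pull (len_pull hX f) g')
        (comp (q (len_pull hX f) g') (q hX f));
  pull_universal : forall (X Y Z : ccat) (hX : 0 < len X)
      (f : hom Y (ft X)) (u : hom Z Y) (v : hom Z X),
    comp u f = comp v (pr X) ->
    exists! w : hom Z (pull hX f),
      comp w (cast_cod (ft_pull hX f) (pr (pull hX f))) = u
      /\ comp w (q hX f) = v
}.
Arguments len {c} X.
Arguments ft {c} X.
Arguments pr {c} X.

Definition is_section (CC : Csystem) (X : CC) (s : hom (ft X) X) : Prop :=
  comp s (pr X) = idm (ft X).

Record Obtilde (CC : Csystem) := MkObtilde {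
  ob_cod : CC;
  ob_len : 0 < len ob_cod;
  ob_mor : hom (ft ob_cod) ob_cod;
  ob_sec : is_section ob_mor
}.

(* stn(n) is ['I_n]. *)
Record JfRelMonad := {
  carrier :> nat -> Type;
  eta : forall n, 'I_n -> carrier n;
  rho : forall m n, ('I_m -> carrier n) -> carrier m -> carrier n;
  rho_eta : forall n, rho (@eta n) = id;
  eta_rho : forall m n (f : 'I_m -> carrier n), @eta m \; rho f = f;
  rho_rho : forall l m n (f : 'I_l -> carrier m) (g : 'I_m -> carrier n),
    rho f \; rho g = rho (f \; rho g)
}.
Arguments eta {j} n _.
Arguments rho {j m n} f _.

Section CsystemOfRelMonad.
Variable R : JfRelMonad.

Lemma eta_rhoE m n (f : 'I_m -> R n) i : rho f (eta m i) = f i.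
Proof. exact: (congr1 (fun g => g i) (eta_rho f)). Qed.

Lemma rho_rhoE l m n (f : 'I_l -> R m) (g : 'I_m -> R n) x :
  rho g (rho f x) = rho (f \; rho g) x.
Proof. exact: (congr1 (fun h => h x) (rho_rho f g)). Qed.

Lemma kleisli_idr m n (f : 'I_m -> R n) : f \; rho (eta n) = f.
Proof. by rewrite rho_eta. Qed.

Lemma kleisli_assoc k l m n
    (f : 'I_k -> R l) (g : 'I_l -> R m) (h : 'I_m -> R n) :
  (f \; rho g) \; rho h = f \; rho (g \; rho h).
Proof. by rewrite -rho_rho. Qed.

Definition kleisli : category :=
  @Category nat (fun m n => 'I_m -> R n) (@eta R)
    (fun l m n f g => f \; rho g)
    (fun m n f => eta_rho f) kleisli_idr kleisli_assoc.

Definition L m n (f : 'I_m -> 'I_n) : 'I_m -> R n := f \; eta n.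

Definition iota1 n : 'I_n -> 'I_n.+1 := widen_ord (leqnSn n).

(* The sequence (f(0), ..., f(n-1), o). *)
Definition snoc n T (f : 'I_n -> T) (o : T) : 'I_n.+1 -> T :=
  fun i => if unlift ord_max i is Some j then f j else o.

Lemma iota1E n (i : 'I_n) : iota1 i = lift ord_max i.
Proof. by apply: val_inj; rewrite /= /bump leqNgt ltn_ord. Qed.

Lemma snoc_iota1 n T (f : 'I_n -> T) o i : snoc f o (iota1 i) = f i.
Proof. by rewrite iota1E /snoc liftK. Qed.

Lemma snoc_max n T (f : 'I_n -> T) o : snoc f o ord_max = o.
Proof. by rewrite /snoc unlift_none. Qed.

Lemma snocP n T (f : 'I_n -> T) o (g : 'I_n.+1 -> T) :
  (forall i, g (iota1 i) = f i) -> g ord_max = o -> g = snoc f o.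
Proof.
move=> gf go; apply: functional_extensionality => i; rewrite /snoc.
by case: unliftP => [j ->|->//]; rewrite -iota1E gf.
Qed.

Definition Cpr (X : nat) : 'I_X.-1 -> R X :=
  match X with
  | 0 => eta 0
  | n.+1 => L (@iota1 n)
  end.

Arguments Cpr X _ : clear implicits.

(* For f = (f_0, ..., f_{n-1}) : Y -> n, the morphism q(f, n+1) : Y+1 -> n+1 is
   (f_0, ..., f_{n-1}, x_Y^{Y+1}), each f_i being transported to R(Y+1) along
   iota^1_Y. *)
Definition Cq (X Y : nat) : 0 < X -> ('I_X.-1 -> R Y) -> ('I_X -> R Y.+1) :=
  match X with
  | 0 => fun h0 => False_rect _ (notF h0)
  | n.+1 => fun _ f => snoc (f \; rho (L (@iota1 Y))) (eta Y.+1 ord_max)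
  end.

Let C := opposite kleisli.

Lemma C_len_eq0 (X : C) : (X : nat) = 0 <-> X = 0.
Proof. by []. Qed.

Lemma C_pt_final (X : C) :
  exists f : @hom C X 0, forall g : @hom C X 0, g = f.
Proof.
have f : 'I_0 -> R X by case.
by exists f => g; apply: functional_extensionality; case.
Qed.

Lemma C_square (X Y : C) (hX : 0 < X) (f : @hom C Y X.-1) :
  comp (Cpr Y.+1 : @hom C Y.+1 Y) f = comp (Cq hX f : @hom C Y.+1 X) (Cpr X).
Proof.
case: X hX f => [//|n] hX f; apply: functional_extensionality => i /=.
by rewrite /L /= eta_rhoE snoc_iota1.
Qed.

Lemma C_pull_id (X : C) (hX : 0 < X) :
  existT (fun T => @hom C T X) X.-1.+1 (Cq hX (eta X.-1))
  = existT (fun T => @hom C T X) X (eta X).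
Proof.
case: X hX => [//|n] hX; congr existT; apply/esym/snocP => //= i.
by rewrite eta_rhoE.
Qed.

Lemma C_pull_comp (X Y Z : C) (hX : 0 < X)
    (f : @hom C Y X.-1) (g : @hom C Z Y) :
  existT (fun T => @hom C T X) Z.+1 (Cq hX (comp g f))
  = existT (fun T => @hom C T X) Z.+1
      (comp (Cq (ltn0Sn Y) g : @hom C Z.+1 Y.+1) (Cq hX f)).
Proof.
case: X hX f => [//|n] hX f; congr existT; apply/esym/snocP => [i|] /=.
  rewrite snoc_iota1 /= !rho_rhoE; congr (rho _ _).
  by apply: functional_extensionality => j; rewrite /L /= eta_rhoE snoc_iota1.
by rewrite snoc_max eta_rhoE snoc_max.
Qed.

Lemma C_universal (X Y Z : C) (hX : 0 < X)
    (f : @hom C Y X.-1) (u : @hom C Z Y) (v : @hom C Z X) :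
  comp u f = comp v (Cpr X : @hom C X X.-1) ->
  exists! w : @hom C Z Y.+1,
    comp w (Cpr Y.+1 : @hom C Y.+1 Y) = u
    /\ comp w (Cq hX f : @hom C Y.+1 X) = v.
Proof.
case: X hX f v => [//|n] hX f v /= fuv.
have fuvE i : rho u (f i) = v (iota1 i).
  have /= -> := congr1 (fun g => g i) fuv.
  by rewrite /L /= eta_rhoE.
have pE (w : 'I_Y.+1 -> R Z) : L (@iota1 Y) \; rho w = @iota1 Y \; w.
  by apply: functional_extensionality => i; rewrite /L /= eta_rhoE.
exists (snoc u (v ord_max)); split.
  have pu : @iota1 Y \; snoc u (v ord_max) = u.
    by apply: functional_extensionality => i /=; rewrite snoc_iota1.
  split; first exact: etrans (pE _) pu.
  have vE : v = snoc (@iota1 n \; v) (v ord_max) by exact: snocP.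
  apply/(etrans _ (esym vE))/snocP => [i|] /=.
    by rewrite snoc_iota1 /= rho_rhoE pE pu fuvE.
  by rewrite snoc_max eta_rhoE snoc_max.
move=> w [wu wv]; apply/esym/snocP => [i|].
  by rewrite -wu /= /L /= eta_rhoE.
by rewrite -wv /= snoc_max eta_rhoE.
Qed.

Definition CRR : Csystem :=
  @Build_Csystem C (fun n => n) 0 predn Cpr
    (fun X Y _ _ => Y.+1) Cq
    C_len_eq0 (fun X _ => erefl) erefl C_pt_final
    (fun X Y _ _ => ltn0Sn Y) (fun X Y _ _ => erefl)
    C_square C_pull_id C_pull_comp C_universal.

Definition mb (s : Obtilde CRR) : {n : nat & R n} :=
  match s with
  | MkObtilde X hX f _ =>
      match X return 0 < X -> ('I_X -> R X.-1) -> {n : nat & R n} with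
      | 0 => fun h0 _ => False_rect _ (notF h0)
      | n.+1 => fun _ f => existT R n (f ord_max)
      end hX f
  end.

Definition mb_inv_mor n (o : R n) :
  @hom CRR (@ft CRR n.+1) n.+1 := snoc (eta n) o.

(* [sec] is a proof that the sequences (x_0^n, ..., x_{n-1}^n, o) are sections
   of the canonical projections. *)
Definition mb_inv
    (sec : forall n (o : R n), @is_section CRR n.+1 (mb_inv_mor o))
    (u : {n : nat & R n}) : Obtilde CRR :=
  @MkObtilde CRR (projT1 u).+1 (ltn0Sn _) (mb_inv_mor (projT2 u))
    (sec (projT1 u) (projT2 u)).

End CsystemOfRelMonad.

Arguments mb {R} s.
Arguments mb_inv_mor {R n} o.
Arguments mb_inv {R} sec u.

(* Main.v *)
Require Import Defs.
From mathcomp Require Import all_boot.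
From Stdlib Require Import FunctionalExtensionality ProofIrrelevance.

(** Since [p] is [L (iota1 n)], that is, the sequence [(x_0, ..., x_{n-1})],
    the law [eta_rho] turns the composite of [s] with [p] into the sequence of
    the first [n] entries of [s].  Hence [s] is a section exactly when these
    entries are the variables of [RR n] ([is_sectionP]).  The last entry of a
    section is arbitrary and determines it, and [snoc] makes this
    correspondence explicit. *)

Lemma is_sectionP (RR : JfRelMonad) (n : nat)
    (s : @hom (CRR RR) (@ft (CRR RR) n.+1) n.+1) :
  @is_section (CRR RR) n.+1 s <-> forall i, s (iota1 i) = eta n i.
Proof.
split=> [sec i | sE].
  rewrite -[RHS]/(@idm (CRR RR) n i) -sec /=.
  by rewrite /L /= eta_rhoE.
by apply: functional_extensionality => i; rewrite /= /L /= eta_rhoE.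
Qed.

Lemma mb_inv_mor_section (RR : JfRelMonad) (n : nat) (o : RR n) :
  @is_section (CRR RR) n.+1 (mb_inv_mor o).
Proof. by apply/is_sectionP => i; apply: snoc_iota1. Qed.

(** The two remaining fields of [Obtilde] are proofs, so an element over a
    given codomain is determined by its underlying morphism. *)
Lemma MkObtilde_eq (CC : Csystem) (X : CC) (hX hX' : 0 < len X)
    (s s' : hom (ft X) X) (sec : is_section s) (sec' : is_section s') :
  s = s' -> MkObtilde hX sec = MkObtilde hX' sec'.
Proof.
move=> ss'; case: s' / ss' sec' => sec'.
by rewrite (bool_irrelevance hX hX') (proof_irrelevance _ sec sec').
Qed.

Lemma mbK (RR : JfRelMonad) : cancel (@mb RR) (mb_inv (@mb_inv_mor_section RR)).
Proof.
case=> -[//|n] hX s sec; apply: MkObtilde_eq.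
by apply/esym/snocP => //; apply/is_sectionP.
Qed.

Lemma mb_invK (RR : JfRelMonad) :
  cancel (mb_inv (@mb_inv_mor_section RR)) (@mb RR).
Proof. by case=> n o; rewrite /= /mb_inv_mor snoc_max. Qed.

Theorem mainTheorem5 (RR : JfRelMonad) :
  bijective (@mb RR) /\
  exists sec : forall (n : nat) (o : RR n),
      @is_section (CRR RR) n.+1 (mb_inv_mor o),
    cancel (@mb RR) (mb_inv sec) /\ cancel (mb_inv sec) (@mb RR).
Proof.
split; first exact: Bijective (@mbK RR) (@mb_invK RR).
by exists (@mb_inv_mor_section RR); split; [apply: mbK | apply: mb_invK].
Qed.
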